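(* For all integers $n\ge 0$ and $\alpha\ge 1$, \[\overline{p}_3(7^4 n)\equiv \overline{p}_3(7^2 n)\pmod 7,\] and \[\overline{p}_3\big(7^{2\alpha+1}(7n+3)\big)\equiv \overline{p}_3\big(7^{2\alpha+1}(7n+5)\big)\equiv \overline{p}_3\big(7^{2\alpha+1}(7n+6)\big)\equiv 0\pmod 7.\]
   Context: An overpartition of $n$ is a partition of $n$ in which the first occurrence of each distinct part may (or may not) be overlined. An overpartition triple of $n$ is a triple of overpartitions whose parts together sum to $n$. $\overline{p}_3(n)$ denotes the number of overpartition triples of $n$, with $\overline{p}_3(0)=1$; equivalently $\sum_{n\ge0}\overline{p}_3(n)q^n=\big((-q;q)_\infty/(q;q)_\infty\big)^3$, where $(a;q)_\infty=\prod_{n\ge0}(1-aq^n)$. *)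

(* Defs.v *)
From mathcomp Require Import all_boot.

Set Implicit Arguments.
Unset Strict Implicit.
Unset Printing Implicit Defensive.

(* An overpartition is the nonincreasing sequence of its parts; the boolean
   attached to a part tells whether that part is overlined. In such a sequence
   equal parts are consecutive, so only the first occurrence of each part may
   be overlined iff no part that equals its predecessor is overlined. *)
Definition overpartition_step (x y : nat * bool) : bool :=
  (y.1 < x.1) || (y.1 == x.1) && ~~ y.2.

Definition overpartition (s : seq (nat * bool)) : bool :=
  all (fun x => 0 < x.1) s && sorted overpartition_step s.

Definition weight (s : seq (nat * bool)) : nat := \sum_(x <- s) x.1.

(* Sequences of length at most n with parts at most n: a finite type that is
   large enough to contain every overpartition of weight at most n, see
   [overpartition_bounded] below. *)
Definition bounded_seq (n : nat) := {bseq n of 'I_n.+1 * bool}.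

Definition seq_of (n : nat) (s : bounded_seq n) : seq (nat * bool) :=
  [seq (nat_of_ord x.1, x.2) | x <- s].

Definition overpartition_triples (n : nat) :
    {set bounded_seq n * bounded_seq n * bounded_seq n} :=
  [set t | [&& overpartition (seq_of t.1.1), overpartition (seq_of t.1.2),
               overpartition (seq_of t.2)
             & weight (seq_of t.1.1) + weight (seq_of t.1.2)
               + weight (seq_of t.2) == n]].

Definition p3bar (n : nat) : nat := #|overpartition_triples n|.

Lemma seq_of_inj n : injective (@seq_of n).
Proof.
move=> s t est; apply: val_inj; apply: inj_map est => -[i a] [j b] [eij ->].
by rewrite (val_inj eij).
Qed.

Lemma overpartition_bounded n (s : seq (nat * bool)) :
  overpartition s -> weight s <= n -> exists t : bounded_seq n, seq_of t = s.
Proof.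
case/andP=> /allP s_gt0 _ le_s_n.
have le_size : size s <= n.
  apply: leq_trans le_s_n; rewrite /weight -sum1_size.
  by rewrite big_seq [leqRHS]big_seq; apply: leq_sum => x /s_gt0.
pose u := [seq (inord x.1 : 'I_n.+1, x.2) | x <- s].
have size_u : size u <= n by rewrite size_map.
exists (Bseq size_u); rewrite /seq_of /= -map_comp.
apply: map_id_in => -[k b] xs /=; rewrite inordK // ltnS.
apply: leq_trans le_s_n; rewrite /weight.
by rewrite (big_rem (k, b)) //= leq_addr.
Qed.

Lemma p3bar0 : p3bar 0 = 1.
Proof.
rewrite /p3bar; apply/eqP/cards1P; exists ([bseq], [bseq], [bseq]).
apply/setP=> -[[r s] t]; rewrite [r]bseq0 [s]bseq0 [t]bseq0 !inE eqxx.
by rewrite /overpartition /seq_of /weight /= !big_nil.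
Qed.

(* Main.v *)
(* Let [phi(q) = \sum_{k in Z} q^(k^2)] and let [r_k(n)] be the number of
   representations of [n] as a sum of [k] squares. By Gauss' identity the
   generating function of [p3bar] is [phi(-q)^-3], which is congruent to
   [phi(-q)^4 / phi(-q^7)] modulo 7. Since [r_4(7 n) = r_4(n)] modulo 7,
   extracting the exponents divisible by 7 leaves [phi(-q)^4 / phi(-q)], so that
   [p3bar (7 n) = (-1)^n r_3(n)] modulo 7. The theorem then follows from
   [r_3(49 n) = (8 - (-n | 7)) r_3(n) - 7 r_3(n / 49)].
   Both facts on [r_3] and [r_4] come from counting, in two ways, the pairs of a
   vector [v] and a quaternion [p] of norm 7 (up to right units) such that
   [v = p w], respectively [v = p w p^*], for some integral [w]. *)
Require Import Defs.
From Stdlib Require Import ZArith.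
From mathcomp Require Import all_boot.
From mathcomp Require Import zify ssrZ.

Set Implicit Arguments.
Unset Strict Implicit.
Unset Printing Implicit Defensive.

(** * Quaternions of norm 7 acting on sums of squares *)

(** Pairs [(v, i)] with [P i v] are counted first by [v], then by [i]: each [f i] is a bijection
    from [L] onto the members of [M] satisfying [P i]. *)
Lemma double_count (I V : eqType) (s : seq I) (L M : seq V)
    (f g : I -> V -> V) (P : I -> pred V) :
    uniq L -> uniq M ->
    {in s, forall i, cancel (f i) (g i)} ->
    {in s, forall i u, u \in L -> P i (f i u) && (f i u \in M)} ->
    {in s, forall i v, v \in M -> P i v -> f i (g i v) = v /\ g i v \in L} ->
  \sum_(v <- M) count (P^~ v) s = size s * size L.
Proof.
move=> uL uM fK fL gM; under eq_bigr do rewrite -sum1_count big_mkcond.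
rewrite exchange_big /= -sum1_size big_distrl; apply: eq_big_seq => i si /=.
rewrite mul1n -big_mkcond sum1_count -size_filter -[size L](size_map (f i)).
apply/perm_size/uniq_perm; first exact: filter_uniq.
  by rewrite map_inj_uniq //; apply: can_inj (fK i si).
move=> v; rewrite mem_filter; apply/andP/mapP => [[Pv vM]|[u uL' ->]].
  by have [fgK gL] := gM _ si _ vM Pv; exists (g i v); rewrite ?fgK.
exact/andP/fL.
Qed.

Definition zrange (B : nat) : seq Z :=
  [seq (Z.of_nat k - Z.of_nat B)%Z | k <- iota 0 (2 * B).+1].

Lemma mem_zrange B x :
  (x \in zrange B) = Z.leb (- Z.of_nat B) x && Z.leb x (Z.of_nat B).
Proof.
apply/mapP/idP => [[k]|xB]; first by rewrite mem_iota => kB ->; lia.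
by exists (Z.to_nat (x + Z.of_nat B)); [rewrite mem_iota; lia | lia].
Qed.

Lemma zrange_uniq B : uniq (zrange B).
Proof. by rewrite map_inj_uniq ?iota_uniq // => j k; lia. Qed.

Definition vec := (Z * Z * Z)%type.
Definition quat := (Z * Z * Z * Z)%type.

Definition vnorm (v : vec) : Z :=
  let: (x, y, z) := v in (x * x + y * y + z * z)%Z.
Definition qnorm (v : quat) : Z :=
  let: (x, y, z, t) := v in (x * x + y * y + z * z + t * t)%Z.

Definition vmap (f : Z -> Z) (v : vec) : vec :=
  let: (x, y, z) := v in (f x, f y, f z).
Definition qmap (f : Z -> Z) (v : quat) : quat :=
  let: (x, y, z, t) := v in (f x, f y, f z, f t).

Definition vdvd (m : Z) (v : vec) : bool :=
  let: (x, y, z) := v in [&& x mod m =? 0, y mod m =? 0 & z mod m =? 0]%Z.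
Definition qdvd (m : Z) (v : quat) : bool :=
  let: (x, y, z, t) := v in
  [&& x mod m =? 0, y mod m =? 0, z mod m =? 0 & t mod m =? 0]%Z.

Definition qconj (p : quat) : quat :=
  let: (a, b, c, d) := p in (a, - b, - c, - d)%Z.

Definition qmul (p v : quat) : quat :=
  let: (a, b, c, d) := p in let: (x, y, z, t) := v in
  (a * x - b * y - c * z - d * t, a * y + b * x + c * t - d * z,
   a * z - b * t + c * x + d * y, a * t + b * z - c * y + d * x)%Z.

(* The pure quaternion [p * v * qconj p]. *)
Definition qrot (p : quat) (v : vec) : vec :=
  let: (a, b, c, d) := p in let: (x, y, z) := v in
  ((a * a + b * b - c * c - d * d) * x + 2 * (b * c - a * d) * y
     + 2 * (b * d + a * c) * z,
   2 * (b * c + a * d) * x + (a * a - b * b + c * c - d * d) * y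
     + 2 * (c * d - a * b) * z,
   2 * (b * d - a * c) * x + 2 * (c * d + a * b) * y
     + (a * a - b * b - c * c + d * d) * z)%Z.

(* Every quaternion of norm 7 is one of these eight up to a right unit. *)
Definition quats7 : seq quat :=
  [seq (2, x.1.1, x.1.2, x.2)%Z |
     x <- allpairs pair (allpairs pair [:: 1; -1] [:: 1; -1]) [:: 1; -1]]%Z.

Definition residues : seq Z := [:: 0; 1; 2; 3; 4; 5; 6]%Z.

Definition vresidues : seq vec :=
  allpairs pair (allpairs pair residues residues) residues.
Definition qresidues : seq quat := allpairs pair vresidues residues.


Definition vaddm (m : Z) (v w : vec) : vec :=
  let: (x, y, z) := v in let: (x', y', z') := w in
  (x + x' * m, y + y' * m, z + z' * m)%Z.
Definition qaddm (m : Z) (v w : quat) : quat :=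
  let: (x, y, z, t) := v in let: (x', y', z', t') := w in
  (x + x' * m, y + y' * m, z + z' * m, t + t' * m)%Z.

(** Modulo 7 the quaternions are the 2 by 2 matrices, and the eight [p] have as images the eight
    lines of the plane over ['F_7]. The condition says that the image of [v] lies in that of [p]:
    this holds for one line if [v] is singular and nonzero, and for all eight if [v] is zero. *)
Lemma qcount_residues :
  all (fun v => (qnorm v mod 7 =? 0)%Z ==>
      (count (fun p => qdvd 7 (qmul (qconj p) v)) quats7 %% 7 == 1)) qresidues.
Proof. by lazy. Qed.

(** In the same model the condition says that the line of [p] is stable under the traceless matrix
    [v], whose eigenvalues are the square roots of minus its norm. Norms 3, 5, 6 give two
    eigenlines; norm 0 gives one, or eight if [v] is zero. *)
Lemma vcount_residues :
  all (fun v => let c := count (fun p => vdvd 7 (qrot (qconj p) v)) quats7 in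
         let r := (vnorm v mod 7)%Z in
         if (r =? 0)%Z then c %% 7 == 1
         else has (Z.eqb r) [:: 3; 5; 6]%Z ==> (c == 2)) vresidues.
Proof. by lazy. Qed.

(* The classes modulo 49 are represented by [v + 7 w], for residues [v] and [w]
   modulo 7. *)
Lemma vcount_residues2 :
  all (fun v => (vnorm v mod 7 =? 0)%Z && ~~ vdvd 7 v ==>
    all (fun w => (vnorm (vaddm 7 v w) mod 49 =? 0)%Z ==>
      (count (fun p => vdvd 49 (qrot (qconj p) (vaddm 7 v w))) quats7 == 1))
    vresidues) vresidues.
Proof. by lazy. Qed.

(** * Passage from residue classes to integral vectors and quaternions *)

Lemma vdvd_addm m v w : vdvd m (vaddm m v w) = vdvd m v.
Proof. by case: v w => [[x y] z] [[x' y'] z'] /=; rewrite !Z_mod_plus_full. Qed.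

Lemma qdvd_addm m v w : qdvd m (qaddm m v w) = qdvd m v.
Proof.
by case: v w => [[[x y] z] t] [[[x' y'] z'] t'] /=; rewrite !Z_mod_plus_full.
Qed.

Lemma qrot_addm m p v w : qrot p (vaddm m v w) = vaddm m (qrot p v) (qrot p w).
Proof.
case: p v w => [[[a b] c] d] [[x y] z] [[x' y'] z'] /=.
by congr (_, _, _); ring.
Qed.

Lemma qmul_addm m p v w : qmul p (qaddm m v w) = qaddm m (qmul p v) (qmul p w).
Proof.
case: p v w => [[[a b] c] d] [[[x y] z] t] [[[x' y'] z'] t'] /=.
by congr (_, _, _, _); ring.
Qed.

Lemma vnorm_addm m v w : (vnorm (vaddm m v w) mod m = vnorm v mod m)%Z.
Proof.
case: v w => [[x y] z] [[x' y'] z'] /=; set a := (x * x + y * y + z * z)%Z.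
pose b := (2 * (x * x' + y * y' + z * z')
  + (x' * x' + y' * y' + z' * z') * m)%Z.
rewrite -(Z_mod_plus_full a b m); congr (_ mod _)%Z; rewrite /a /b; ring.
Qed.

Lemma qnorm_addm m v w : (qnorm (qaddm m v w) mod m = qnorm v mod m)%Z.
Proof.
case: v w => [[[x y] z] t] [[[x' y'] z'] t'] /=.
set a := (x * x + y * y + z * z + t * t)%Z.
pose b := (2 * (x * x' + y * y' + z * z' + t * t')
  + (x' * x' + y' * y' + z' * z' + t' * t') * m)%Z.
rewrite -(Z_mod_plus_full a b m); congr (_ mod _)%Z; rewrite /a /b; ring.
Qed.

Lemma vaddm_divmod m v :
  v = vaddm m (vmap (Z.modulo^~ m) v) (vmap (Z.div^~ m) v).
Proof.
case: v => [[x y] z] /=.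
have E u : (u = u mod m + u / m * m)%Z.
  by rewrite {1}(Z_div_mod_eq_full u m); ring.
by rewrite -!E.
Qed.

Lemma qaddm_divmod m v :
  v = qaddm m (qmap (Z.modulo^~ m) v) (qmap (Z.div^~ m) v).
Proof.
case: v => [[[x y] z] t] /=.
have E u : (u = u mod m + u / m * m)%Z.
  by rewrite {1}(Z_div_mod_eq_full u m); ring.
by rewrite -!E.
Qed.

Lemma vdvdP m v : vdvd m v -> v = vmap (Z.mul m) (vmap (Z.div^~ m) v).
Proof.
case: v => [[x y] z] /and3P[/Z.eqb_eq x0 /Z.eqb_eq y0 /Z.eqb_eq z0] /=.
have E u : (u mod m = 0 -> u = m * (u / m))%Z.
  by move=> u0; rewrite {1}(Z_div_mod_eq_full u m) u0; ring.
by rewrite -!E.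
Qed.

Lemma qdvdP m v : qdvd m v -> v = qmap (Z.mul m) (qmap (Z.div^~ m) v).
Proof.
case: v => [[[x y] z] t].
case/and4P=> /Z.eqb_eq x0 /Z.eqb_eq y0 /Z.eqb_eq z0 /Z.eqb_eq t0 /=.
have E u : (u mod m = 0 -> u = m * (u / m))%Z.
  by move=> u0; rewrite {1}(Z_div_mod_eq_full u m) u0; ring.
by rewrite -!E.
Qed.

Lemma vdvd_scale m v : vdvd m (vmap (Z.mul m) v).
Proof. by case: v => [[x y] z] /=; rewrite !(Z.mul_comm m) !Z_mod_mult. Qed.

Lemma qdvd_scale m v : qdvd m (qmap (Z.mul m) v).
Proof. by case: v => [[[x y] z] t] /=; rewrite !(Z.mul_comm m) !Z_mod_mult. Qed.

Lemma vdiv_scale m v : m <> 0%Z -> vmap (Z.div^~ m) (vmap (Z.mul m) v) = v.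
Proof.
by move=> m0; case: v => [[x y] z] /=; rewrite !(Z.mul_comm m) !Z_div_mult_full.
Qed.

Lemma qdiv_scale m v : m <> 0%Z -> qmap (Z.div^~ m) (qmap (Z.mul m) v) = v.
Proof.
move=> m0; case: v => [[[x y] z] t] /=.
by rewrite !(Z.mul_comm m) !Z_div_mult_full.
Qed.

Lemma vnorm_scale m v : vnorm (vmap (Z.mul m) v) = (m * m * vnorm v)%Z.
Proof. by case: v => [[x y] z] /=; ring. Qed.

Lemma qmul_scale p m v : qmul p (qmap (Z.mul m) v) = qmap (Z.mul m) (qmul p v).
Proof.
by case: p v => [[[a b] c] d] [[[x y] z] t] /=; congr (_, _, _, _); ring.
Qed.

Lemma qrot_scale p m v : qrot p (vmap (Z.mul m) v) = vmap (Z.mul m) (qrot p v).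
Proof. by case: p v => [[[a b] c] d] [[x y] z] /=; congr (_, _, _); ring. Qed.

Lemma qconjK : involutive qconj.
Proof. by case=> [[[a b] c] d] /=; rewrite !Z.opp_involutive. Qed.

Lemma qnorm_conj p : qnorm (qconj p) = qnorm p.
Proof. by case: p => [[[a b] c] d] /=; ring. Qed.

Lemma qnorm_mul p v : qnorm (qmul p v) = (qnorm p * qnorm v)%Z.
Proof. by case: p v => [[[a b] c] d] [[[x y] z] t] /=; ring. Qed.

Lemma vnorm_rot p v : vnorm (qrot p v) = (qnorm p * qnorm p * vnorm v)%Z.
Proof.
by case: p v => [[[a b] c] d] [[x y] z]; rewrite /qrot /vnorm /qnorm; ring.
Qed.

Lemma qmul_conj p v : qmul (qconj p) (qmul p v) = qmap (Z.mul (qnorm p)) v.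
Proof.
by case: p v => [[[a b] c] d] [[[x y] z] t] /=; congr (_, _, _, _); ring.
Qed.

Lemma qrot_conj p v :
  qrot (qconj p) (qrot p v) = vmap (Z.mul (qnorm p * qnorm p)) v.
Proof.
case: p v => [[[a b] c] d] [[x y] z]; rewrite /qconj /qrot /qnorm /vmap.
by congr (_, _, _); ring.
Qed.

Lemma mem_residues u : (u mod 7)%Z \in residues.
Proof.
have := Z.mod_pos_bound u 7 erefl; move: (u mod 7)%Z => r r_lt7.
have: (r = 0 \/ r = 1 \/ r = 2 \/ r = 3 \/ r = 4 \/ r = 5 \/ r = 6)%Z by lia.
by do 6![case=> [-> //|]] => ->.
Qed.

Lemma mem_vresidues v : vmap (Z.modulo^~ 7%Z) v \in vresidues.
Proof.
by case: v => [[x y] z] /=; do !apply: allpairs_f; apply: mem_residues.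
Qed.

Lemma mem_qresidues v : qmap (Z.modulo^~ 7%Z) v \in qresidues.
Proof.
case: v => [[[x y] z] t] /=; apply: allpairs_f; last exact: mem_residues.
exact: (mem_vresidues (x, y, z)).
Qed.

Lemma qcount_mod7 v : (qnorm v mod 7 = 0)%Z ->
  count (fun p => qdvd 7 (qmul (qconj p) v)) quats7 %% 7 = 1.
Proof.
move=> v0; have /implyP := allP qcount_residues _ (mem_qresidues v).
rewrite {1}(@qaddm_divmod 7 v) qnorm_addm in v0.
rewrite v0 => /(_ isT)/eqP; congr (_ %% _ = _).
apply: eq_count => p /=.
by rewrite [in RHS](@qaddm_divmod 7 v) qmul_addm qdvd_addm.
Qed.

Lemma vcount7 v : let c := count (fun p => vdvd 7 (qrot (qconj p) v)) quats7 in
  ((vnorm v mod 7 = 0)%Z -> c %% 7 = 1) /\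
  (has (Z.eqb (vnorm v mod 7)) [:: 3; 5; 6]%Z -> c = 2).
Proof.
have := allP vcount_residues _ (mem_vresidues v).
rewrite (_ : count _ _ = count (fun p => vdvd 7 (qrot (qconj p) v)) quats7);
  last first.
  apply: eq_count => p /=.
  by rewrite [in RHS](@vaddm_divmod 7 v) qrot_addm vdvd_addm.
have ->: (vnorm (vmap (Z.modulo^~ 7) v) mod 7 = vnorm v mod 7)%Z.
  by rewrite [in RHS](@vaddm_divmod 7 v) vnorm_addm.
move=> /=; case: ifP => [/Z.eqb_eq -> /eqP //|/Z.eqb_neq ? /implyP h].
by split=> // /h/eqP.
Qed.

Lemma vaddmA m u v w :
  vaddm m u (vaddm m v w) = vaddm (m * m) (vaddm m u v) w.
Proof.
case: u v w => [[x y] z] [[x' y'] z'] [[x'' y''] z''] /=.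
by congr (_, _, _); ring.
Qed.

Lemma vcount49 v : (vnorm v mod 49 = 0)%Z -> ~~ vdvd 7 v ->
  count (fun p => vdvd 49 (qrot (qconj p) v)) quats7 = 1.
Proof.
(* The two lowest base 7 digits of each coordinate, held by [v mod 7] and [w mod 7], determine [v]
   modulo 49. *)
move=> v0 nv; pose w := vmap (Z.div^~ 7%Z) v; pose u := vmap (Z.div^~ 7%Z) w.
have Ev : v = vaddm 7 (vmap (Z.modulo^~ 7%Z) v) w by apply: vaddm_divmod.
have Ew : w = vaddm 7 (vmap (Z.modulo^~ 7%Z) w) u by apply: vaddm_divmod.
have Ev2 : v = vaddm 49
    (vaddm 7 (vmap (Z.modulo^~ 7%Z) v) (vmap (Z.modulo^~ 7%Z) w)) u.
  by rewrite {1}Ev {1}Ew vaddmA.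
have v07 : (vnorm v mod 7 = 0)%Z by Z.to_euclidean_division_equations; lia.
rewrite {1}Ev vnorm_addm in v07; rewrite {1}Ev vdvd_addm in nv.
have /implyP := allP vcount_residues2 _ (mem_vresidues v).
rewrite v07 nv => /(_ isT)/allP/(_ _ (mem_vresidues w))/implyP.
rewrite {1}Ev2 vnorm_addm in v0.
rewrite v0 => /(_ isT)/eqP; congr (_ = _); apply: eq_count => p /=.
by rewrite [in RHS]Ev2 (qrot_addm 49) vdvd_addm.
Qed.

(** * Numbers of representations by three and four squares *)

Definition vbox (B : nat) : seq vec :=
  allpairs pair (allpairs pair (zrange B) (zrange B)) (zrange B).
Definition qbox (B : nat) : seq quat := allpairs pair (vbox B) (zrange B).

Definition vreps (B n : nat) : seq vec :=
  [seq v <- vbox B | Z.eqb (vnorm v) (Z.of_nat n)].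
Definition qreps (B n : nat) : seq quat :=
  [seq v <- qbox B | Z.eqb (qnorm v) (Z.of_nat n)].

Lemma vbox_uniq B : uniq (vbox B).
Proof.
by do !apply: allpairs_uniq => //; try exact: zrange_uniq; move=> [? ?] [? ?].
Qed.

Lemma qbox_uniq B : uniq (qbox B).
Proof.
apply: allpairs_uniq; [exact: vbox_uniq | exact: zrange_uniq |].
by move=> [? ?] [? ?].
Qed.

Lemma vreps_uniq B n : uniq (vreps B n).
Proof. exact/filter_uniq/vbox_uniq. Qed.

Lemma qreps_uniq B n : uniq (qreps B n).
Proof. exact/filter_uniq/qbox_uniq. Qed.

(** Each coordinate has square at most [n], hence absolute value at most [n], so every box with
    [n <= B] contains all representations. *)
Lemma mem_vreps B n v : n <= B ->
  (v \in vreps B n) = Z.eqb (vnorm v) (Z.of_nat n).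
Proof.
move=> nB; rewrite mem_filter; case: Z.eqb_spec => //= vn.
have R x : (x * x <= Z.of_nat n)%Z -> x \in zrange B.
  by move=> ?; rewrite mem_zrange; nia.
case: v vn => [[x y] z] /= vn.
by do !apply: allpairs_f; apply: R; nia.
Qed.

Lemma mem_qreps B n v : n <= B ->
  (v \in qreps B n) = Z.eqb (qnorm v) (Z.of_nat n).
Proof.
move=> nB; rewrite mem_filter; case: Z.eqb_spec => //= vn.
have R x : (x * x <= Z.of_nat n)%Z -> x \in zrange B.
  by move=> ?; rewrite mem_zrange; nia.
case: v vn => [[[x y] z] t] /= vn.
by do !apply: allpairs_f; apply: R; nia.
Qed.

Lemma qnorm_quats7 p : p \in quats7 -> qnorm p = 7%Z.
Proof. by move=> pP; apply/Z.eqb_eq; move: p pP; apply/allP. Qed.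

(** There are [8 r_4(n)] pairs [(v, p)] with [v = p w], and each [v] of norm [7 n] occurs in a
    number of them that is 1 modulo 7. *)
Lemma qreps_mod7 B n : 7 * n <= B ->
  size (qreps B (7 * n)) = size (qreps B n) %[mod 7].
Proof.
move=> nB; have nB' : n <= B by lia.
have ->: size (qreps B n) = size quats7 * size (qreps B n) %[mod 7].
  by rewrite -modnMml mul1n.
rewrite -(@double_count _ _ quats7 (qreps B n) (qreps B (7 * n)) qmul
  (fun p v => qmap (Z.div^~ 7%Z) (qmul (qconj p) v))
  (fun p v => qdvd 7 (qmul (qconj p) v))) ?qreps_uniq //.
- rewrite -modn_summ; under eq_big_seq => v.
    rewrite mem_qreps // => /Z.eqb_eq vn.
    rewrite qcount_mod7; last first.
      by rewrite vn; Z.to_euclidean_division_equations; lia.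
    over.
  by rewrite sum1_size.
- by move=> p /qnorm_quats7 p7 v; rewrite qmul_conj p7 qdiv_scale.
- move=> p /qnorm_quats7 p7 v; rewrite !mem_qreps // qmul_conj p7 qdvd_scale.
  move/Z.eqb_eq => vn.
  by rewrite qnorm_mul p7 vn; apply/Z.eqb_eq; lia.
move=> p /qnorm_quats7 p7 v; rewrite !mem_qreps // => /Z.eqb_eq vn /qdvdP.
(* Cancelling 7 in [p (p^* v) = 7 v] with [p^* v = 7 w] gives [v = p w]. *)
set w := qmap (Z.div^~ 7%Z) _ => Ew; have Ev : v = qmul p w.
  have : qmul p (qmul (qconj p) v) = qmap (Z.mul 7) v.
    by rewrite -{1}[p]qconjK qmul_conj qnorm_conj p7.
  rewrite Ew qmul_scale => /(congr1 (qmap (Z.div^~ 7%Z))).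
  by rewrite !qdiv_scale.
split=> //; apply/Z.eqb_eq; move: vn; rewrite Ev qnorm_mul p7; lia.
Qed.

(** Multiplication by 7 is the bijection. The vectors counted here are those that [vreps_nonresidue]
    finds to be counted twice. *)
Lemma vreps_dvd7 B m : 49 * m <= B ->
  count (vdvd 7) (vreps B (49 * m)) = size (vreps B m).
Proof.
move=> mB; have mB' : m <= B by lia.
rewrite -size_filter -[size (vreps B m)](size_map (vmap (Z.mul 7))).
apply/perm_size/uniq_perm; first exact/filter_uniq/vreps_uniq.
  rewrite map_inj_uniq ?vreps_uniq //.
  by apply: (can_inj (g := vmap (Z.div^~ 7%Z))) => v; rewrite vdiv_scale.
move=> v; rewrite mem_filter mem_vreps //.
apply/andP/mapP => [[/vdvdP Ev /Z.eqb_eq vn]|[w]].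
  exists (vmap (Z.div^~ 7%Z) v) => //; rewrite mem_vreps //; apply/Z.eqb_eq.
  by move: vn; rewrite {1}Ev vnorm_scale; lia.
rewrite mem_vreps // => /Z.eqb_eq wn ->; rewrite vdvd_scale vnorm_scale wn.
by split=> //; apply/Z.eqb_eq; lia.
Qed.

(** The double count of [qreps_mod7], with [p w p^*] in place of [p w], so that norms grow by 49. *)
Lemma vreps_count B m : 49 * m <= B ->
  \sum_(v <- vreps B (49 * m))
     count (fun p => vdvd 49 (qrot (qconj p) v)) quats7
    = 8 * size (vreps B m).
Proof.
move=> mB; have mB' : m <= B by lia.
rewrite (@double_count _ _ quats7 (vreps B m) (vreps B (49 * m)) qrot
  (fun p v => vmap (Z.div^~ 49%Z) (qrot (qconj p) v))
  (fun p v => vdvd 49 (qrot (qconj p) v))) ?vreps_uniq //.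
- by move=> p /qnorm_quats7 p7 v; rewrite qrot_conj p7 vdiv_scale.
- move=> p /qnorm_quats7 p7 v; rewrite !mem_vreps // qrot_conj p7 vdvd_scale.
  move/Z.eqb_eq => vn.
  by rewrite vnorm_rot p7 vn; apply/Z.eqb_eq; lia.
move=> p /qnorm_quats7 p7 v; rewrite !mem_vreps // => /Z.eqb_eq vn /vdvdP.
set w := vmap (Z.div^~ 49%Z) _ => Ew; have Ev : v = qrot p w.
  have : qrot p (qrot (qconj p) v) = vmap (Z.mul 49) v.
    by rewrite -{1}[p]qconjK qrot_conj qnorm_conj p7.
  rewrite Ew qrot_scale => /(congr1 (vmap (Z.div^~ 49%Z))).
  by rewrite !vdiv_scale.
split=> //; apply/Z.eqb_eq; move: vn; rewrite Ev vnorm_rot p7; lia.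
Qed.

Lemma vdvd_count7 p v : vdvd 7 v ->
  vdvd 49 (qrot p v) = vdvd 7 (qrot p (vmap (Z.div^~ 7%Z) v)).
Proof.
move=> /vdvdP {1}->; rewrite qrot_scale; case: (qrot _ _) => [[x y] z] /=.
have E u : ((7 * u) mod 49 =? 0)%Z = (u mod 7 =? 0)%Z.
  by apply/Z.eqb_spec/Z.eqb_spec; Z.to_euclidean_division_equations; lia.
by rewrite !E.
Qed.

(** Complements [vcount49]: dividing [v] by 7 leaves a vector of norm [k] and lowers the modulus
    from 49 to 7, where [vcount7] applies. *)
Lemma vcount49_dvd v k :
    (vnorm v = 49 * k)%Z -> vdvd 7 v ->
  let c := count (fun p => vdvd 49 (qrot (qconj p) v)) quats7 in
  ((k mod 7 = 0)%Z -> c %% 7 = 1) /\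
  (has (Z.eqb (k mod 7)) [:: 3; 5; 6]%Z -> c = 2).
Proof.
move=> vn v7 c; rewrite /c {c}; under eq_count => p do rewrite vdvd_count7 //.
have <- : vnorm (vmap (Z.div^~ 7%Z) v) = k.
  move: vn; rewrite {1}(vdvdP v7) vnorm_scale; lia.
exact: vcount7.
Qed.

(** Modulo 7 every vector is counted once: exactly once if 7 does not divide it, and otherwise
    because a seventh of it has norm [7 m]. Hence [r_3(49 * 7 m)] is congruent to [8 r_3(7 m)]. *)
Lemma vreps_mod7 B m : 49 * (7 * m) <= B ->
  size (vreps B (49 * (7 * m))) = size (vreps B (7 * m)) %[mod 7].
Proof.
move=> mB.
have -> : size (vreps B (7 * m)) = 8 * size (vreps B (7 * m)) %[mod 7].
  by rewrite -modnMml mul1n.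
rewrite -vreps_count // -[RHS]modn_summ; under [in RHS]eq_big_seq => v.
  rewrite mem_vreps // => /Z.eqb_eq vn; rewrite (_ : _ %% _ = 1); first over.
  have [v7|nv7] := boolP (vdvd 7 v).
    have [|h _] := @vcount49_dvd v (Z.of_nat (7 * m)) _ v7; first lia.
    by apply: h; Z.to_euclidean_division_equations; lia.
  by rewrite vcount49 //; Z.to_euclidean_division_equations; lia.
by rewrite sum1_size.
Qed.

(** For these [m], [- m] is a nonzero square modulo 7. Vectors divisible by 7 are counted twice and
    the others once, so [r_3(49 m) + r_3(m) = 8 r_3(m)]. *)
Lemma vreps_nonresidue B m : 49 * m <= B -> m %% 7 \in [:: 3; 5; 6] ->
  size (vreps B (49 * m)) = 0 %[mod 7].
Proof.
move=> mB m_nr; have := vreps_count mB; under eq_big_seq => v.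
  rewrite mem_vreps // => /Z.eqb_eq vn.
  rewrite (_ : count _ _ = 1 + vdvd 7 v); first over.
  have [v7|nv7] := boolP (vdvd 7 v).
    have [|_ ->//] := @vcount49_dvd v (Z.of_nat m) _ v7; first lia.
    have -> : (Z.of_nat m mod 7 = Z.of_nat (m %% 7))%Z.
      have := divn_eq m 7; have := ltn_pmod m (isT : 0 < 7).
      by Z.to_euclidean_division_equations; lia.
    by move: m_nr; rewrite !inE => /or3P[]/eqP->.
  by rewrite vcount49 //; Z.to_euclidean_division_equations; lia.
rewrite big_split /= sum1_size -big_mkcond sum1_count vreps_dvd7 // => E.
have {}E : size (vreps B (49 * m)) + size (vreps B m)
  = 8 * size (vreps B m) := E.
rewrite (_ : size (vreps B (49 * m)) = 7 * size (vreps B m)) ?modnMr //; lia.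
Qed.

From mathcomp Require Import all_algebra ring.

Import GRing.Theory.

(** * Overpartitions by largest part *)

Section Overpartitions.

Variable N : nat.
Implicit Types (m n : nat) (s : seq (nat * bool)).

(* Overpartitions with parts at most [m] in which [m] is not overlined. *)
Definition overpartition_upto m s : bool :=
  all (fun x => 0 < x.1) s && path overpartition_step (m, false) s.

Definition bounded_seqs : seq (seq (nat * bool)) :=
  [seq seq_of t | t <- enum {: bounded_seq N}].

(** [N] is separate from the weight [n], so that the recursion, which lowers [n], stays within one
    finite type. *)
Definition upto m n : seq (seq (nat * bool)) :=
  [seq s <- bounded_seqs | overpartition_upto m s && (weight s == n)].

Lemma weight_cons x s : weight (x :: s) = x.1 + weight s.
Proof. by rewrite /weight big_cons. Qed.

Lemma bounded_seqs_uniq : uniq bounded_seqs.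
Proof. by rewrite map_inj_uniq ?enum_uniq //; apply: seq_of_inj. Qed.

Lemma upto_uniq m n : uniq (upto m n).
Proof. exact/filter_uniq/bounded_seqs_uniq. Qed.

Lemma upto_overpartition m s : overpartition_upto m s -> overpartition s.
Proof. by case/andP=> s_gt0 /path_sorted s_sorted; apply/andP. Qed.

Lemma overpartition_mem s :
  overpartition s -> weight s <= N -> s \in bounded_seqs.
Proof.
move=> ov_s /(overpartition_bounded ov_s)[t <-].
by apply: map_f; rewrite mem_enum.
Qed.

Lemma mem_upto m n s : n <= N ->
  (s \in upto m n) = overpartition_upto m s && (weight s == n).
Proof.
move=> nN; rewrite mem_filter andb_idr // => /andP[].
move=> /upto_overpartition ov_s /eqP ws.
by apply: overpartition_mem; rewrite // ws.
Qed.

(** Parts are at most the weight. The bound is [n.+1] and not [n] because [overpartition_upto n]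
    forbids an overlined [n]. *)
Lemma overpartition_upto_weight n s : weight s <= n ->
  overpartition_upto n.+1 s = overpartition s.
Proof.
move=> ws; apply/idP/idP => [/upto_overpartition//|/andP[s_gt0 s_sorted]].
apply/andP; split=> //; case: s ws s_gt0 s_sorted => //= x s.
rewrite weight_cons => ws _ ->; rewrite andbT /overpartition_step /=.
by rewrite ltnS (leq_trans _ ws) ?leq_addr.
Qed.

Lemma overpartition_upto0 s : overpartition_upto 0 s = (s == [::]).
Proof.
case: s => // -[k b] s; rewrite /overpartition_upto /overpartition_step /=.
by case: k => //= k; rewrite andbF.
Qed.

(** Raising the bound from [m] to [m.+1] allows two new heads: a plain [m.+1], which may be
    repeated, and an overlined [m], which only a plain [m] or smaller parts can follow. *)
Lemma overpartition_upto_step m x s : overpartition_upto m.+1 (x :: s) =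
  [|| (x == (m.+1, false)) && overpartition_upto m.+1 s,
      [&& 0 < m, x == (m, true) & overpartition_upto m s]
    | overpartition_upto m (x :: s)].
Proof.
(* A step never looks at the overline of the part that it leaves. *)
have path_fst k b s' : path overpartition_step (k, b) s'
    = path overpartition_step (k, false) s' by case: s'.
have stepE k l c :
  overpartition_step (k, false) (l, c) = (l < k) || (l == k) && ~~ c by [].
case: x => k b; rewrite /overpartition_upto /= path_fst !stepE !xpair_eqE.
case: (ltngtP k m.+1) => [|km|->]; last first.
- by case: b; rewrite ?ltnNge ?leqnSn ?gtn_eqF ?andbF ?orbF.
- by rewrite [k < m]ltnNge (ltnW (ltnW km)) gtn_eqF ?(ltnW km) ?andbF.
rewrite ltnS leq_eqVlt => /predU1P[->|km].
  by rewrite eqxx ltnn /=; case: b; rewrite /= ?andbF ?orbF ?andbT ?andbA //.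
by rewrite km ltn_eqF ?andbF.
Qed.

Lemma size_upto0 n : n <= N -> size (upto 0 n) = (n == 0).
Proof.
move=> nN; case: eqP => [->|/eqP n0] /=.
  apply/(perm_size (s2 := [:: [::]]))/uniq_perm; rewrite ?upto_uniq // => s.
  rewrite mem_upto // overpartition_upto0 inE.
  by case: eqP => // ->; rewrite /weight big_nil.
case E: (upto 0 n) => [//|s t]; have := mem_head s t.
rewrite -E mem_upto // overpartition_upto0 => /andP[/eqP-> ].
by rewrite /weight big_nil eq_sym (negPf n0).
Qed.

(** With [F_m] the generating function for the bound [m], these are the coefficients of
    [(1 - q^(m+1)) F_(m+1) = (1 + q^m) F_m], the term [q^m] being absent for [m = 0]. *)
Lemma size_uptoS m n : n <= N ->
  size (upto m.+1 n) =
    size (upto m n) + (if 0 < m <= n then size (upto m (n - m)) else 0)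
    + (if m < n then size (upto m.+1 (n - m.+1)) else 0).
Proof.
move=> nN; have le_sub k : n - k <= N by apply: leq_trans (leq_subr _ _) nN.
pose A :=
  if 0 < m <= n then [seq (m, true) :: s | s <- upto m (n - m)] else [::].
pose B := if m < n then
  [seq (m.+1, false) :: s | s <- upto m.+1 (n - m.+1)] else [::].
have EA s : (s \in A) =
    [&& 0 < m <= n, s == (m, true) :: behead s & behead s \in upto m (n - m)].
  rewrite /A; case: ifP => //= _.
  apply/mapP/andP => [[s' ? -> /=]|[/eqP-> ?]] //.
  by exists (behead s).
have EB s : (s \in B) =
    [&& m < n, s == (m.+1, false) :: behead s
      & behead s \in upto m.+1 (n - m.+1)].
  rewrite /B; case: ifP => //= _.
  apply/mapP/andP => [[s' ? -> /=]|[/eqP-> ?]] //.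
  by exists (behead s).
have -> : (if 0 < m <= n then size (upto m (n - m)) else 0) = size A.
  by rewrite /A; case: ifP; rewrite ?size_map.
have -> : (if m < n then size (upto m.+1 (n - m.+1)) else 0) = size B.
  by rewrite /B; case: ifP; rewrite ?size_map.
rewrite -!size_cat; apply/perm_size/uniq_perm; first exact: upto_uniq.
- rewrite !cat_uniq upto_uniq /=.
  have uA : uniq A.
    rewrite /A; case: ifP => // _.
    by rewrite map_inj_uniq ?upto_uniq // => ? ? [].
  have uB : uniq B.
    rewrite /B; case: ifP => // _.
    by rewrite map_inj_uniq ?upto_uniq // => ? ? [].
  rewrite uA uB !andbT; apply/andP; split; apply/hasPn => s.
    rewrite EA => /and3P[_ /eqP-> _].
    rewrite mem_upto // /overpartition_upto /=.
    by rewrite /overpartition_step /= ltnn eqxx /= !andbF.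
  rewrite EB mem_cat EA => /and3P[_ /eqP-> _] /=.
  rewrite eqseq_cons xpair_eqE eqn_leq ltnn /= !andbF orbF mem_upto //.
  rewrite /overpartition_upto /overpartition_step /= ltnNge leqnSn /=.
  by rewrite eqn_leq ltnn /= !andbF.
move=> s; rewrite !mem_cat EA EB !mem_upto //; case: s => [|x s] /=.
  by rewrite !andbF !orbF /overpartition_upto.
rewrite overpartition_upto_step !eqseq_cons !eqxx !andbT weight_cons.
have Ew k : (k + weight s == n) = (k <= n) && (weight s == n - k).
  case: leqP => [kn|nk].
    by rewrite -[weight s == n - k](eqn_add2l k) subnKC.
  by rewrite gtn_eqF // ltn_addr.
have [->|nx1] := eqVneq x (m.+1, false).
  rewrite [(m.+1, false) == (m, true)]xpair_eqE !andbF /= orbF Ew.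
  by case: (overpartition_upto m.+1 s) (overpartition_upto m _) (m < n) (_ == _)
    => [] [] [] [].
have [->|nx2] := eqVneq x (m, true); last by rewrite !andbF !orbF.
rewrite andbF orbF /= Ew.
by case: (0 < m) (m <= n) (overpartition_upto m s)
  (overpartition_upto m (_ :: _)) (_ == _) => [] [] [] [] [].
Qed.

End Overpartitions.

(** * Gauss' identity modulo a power of the indeterminate *)

Section TruncatedSeries.

Variable K : fieldType.
Implicit Types p q r : {poly K}.
Local Open Scope ring_scope.

Definition eqmodX (N : nat) p q := forall i, (i < N)%N -> p`_i = q`_i.

Lemma eqmodX_refl N p : eqmodX N p p. Proof. by []. Qed.

Lemma eqmodX_trans N p q r : eqmodX N q p -> eqmodX N p r -> eqmodX N q r.
Proof. by move=> qp pr i iN; rewrite qp // pr. Qed.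

Lemma eqmodXM N p p' q q' :
  eqmodX N p p' -> eqmodX N q q' -> eqmodX N (p * q) (p' * q').
Proof.
move=> pp' qq' i iN; rewrite !coefM; apply: eq_bigr => j _.
by rewrite pp' ?qq' // (leq_ltn_trans _ iN) ?leq_subr // -ltnS.
Qed.

Lemma eqmodXX N p q k : eqmodX N p q -> eqmodX N (p ^+ k) (q ^+ k).
Proof. by move=> pq; elim: k => // k IHk; rewrite !exprS; apply: eqmodXM. Qed.

Lemma eqmodXI N p q r : r`_0 != 0 -> eqmodX N (r * p) (r * q) -> eqmodX N p q.
Proof.
move=> r0 rpq; elim/ltn_ind=> i IHi iN; have := rpq i iN.
rewrite !coefM !big_ord_recl !subn0 /=.
rewrite [X in _ + X = _ -> _](eq_bigr
  (fun j : 'I_i => r`_(bump 0 j) * q`_(i - bump 0 j))).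
  by move/addIr/(mulfI r0).
move=> j _; rewrite IHi //; last by rewrite (leq_ltn_trans _ iN) ?leq_subr.
by rewrite ltn_subrL (leq_ltn_trans _ (ltn_ord j)).
Qed.

Definition ovp (N m : nat) : {poly K} :=
  \poly_(i < N.+1) (size (upto N m i))%:R.

Lemma ovpS N m : eqmodX N.+1 ((1 - 'X^(m.+1)) * ovp N m.+1)
  ((1 + (0 < m)%:R * 'X^m) * ovp N m).
Proof.
move=> i; rewrite ltnS => iN; have subN k : (i - k < N.+1)%N.
  by rewrite ltnS (leq_trans _ iN) ?leq_subr.
rewrite mulrBl mul1r coefB coefXnM !coef_poly ltnS iN subN size_uptoS //.
rewrite ltnS [(i <= m)%N]leqNgt.
case: posnP => [->|m0] /=.
  rewrite mul0r addr0 mul1r coef_poly ltnS iN addn0 natrD.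
  by case: (0 < i)%N; rewrite ?subr0 ?addr0 ?addrK.
rewrite mul1r mulrDl mul1r coefD coefXnM !coef_poly ltnS iN subN !natrD.
rewrite [(i < m)%N]ltnNge.
by case: (m <= i)%N; case: (m < i)%N; rewrite ?subr0 ?addr0 ?addrK.
Qed.

Definition prodD (m : nat) : {poly K} := \prod_(1 <= i < m.+1) (1 + 'X^i).
Definition prodB (m : nat) : {poly K} := \prod_(1 <= i < m.+1) (1 - 'X^i).

Lemma prodBS m : prodB m.+1 = prodB m * (1 - 'X^(m.+1)).
Proof. by rewrite /prodB big_nat_recr. Qed.

Lemma prodDS m : prodD m.+1 = prodD m * (1 + 'X^(m.+1)).
Proof. by rewrite /prodD big_nat_recr. Qed.

Lemma ovp0 N : eqmodX N.+1 (ovp N 0) 1.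
Proof. by move=> i iN; rewrite coef_poly iN size_upto0 // coef1. Qed.

(** Iterates [ovpS]. The numerator stops at [m], since the part [m.+1] may not be overlined. *)
Lemma ovp_prod N m : eqmodX N.+1 (prodB m.+1 * ovp N m.+1) (prodD m).
Proof.
elim: m => [|m IHm].
  rewrite prodBS /prodB /prodD !big_geq // mul1r.
  by apply: eqmodX_trans (@ovpS _ 0) _; rewrite mul0r addr0 mul1r; apply: ovp0.
rewrite prodBS -mulrA.
apply: eqmodX_trans (eqmodXM (@eqmodX_refl _ _) (ovpS _)) _.
rewrite mul1r mulrCA [X in eqmodX _ _ X]prodDS mulrC.
exact: eqmodXM.
Qed.

(* The series [phi(-q)] truncated after the exponent [n ^ 2]; the sign
   [(-1) ^+ j] is the one of [(- 'X) ^+ (j ^ 2)]. *)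
Definition theta (n : nat) : {poly K} :=
  1 + (\sum_(1 <= j < n.+1) (- 'X) ^+ (j ^ 2)) *+ 2.

(* A finite form of Gauss' identity in which the term [j = 0] is [prodB n] and
   the other terms have valuation above [n]. *)
Lemma Gauss_finite n : prodD n * theta n =
  \sum_(0 <= j < n.+1) (-1) ^+ j * (\prod_(0 <= i < j) (1 + 'X^i))
    * (\prod_(j.+1 <= i < n.+1) (1 - 'X^i)) * 'X^(j * n.+1).
Proof.
pose B j : {poly K} := (-1) ^+ j * \prod_(0 <= i < j) (1 + 'X^i).
pose Q j n : {poly K} := \prod_(j.+1 <= i < n.+1) (1 - 'X^i).
rewrite -[RHS]/(\sum_(0 <= j < n.+1) B j * Q j n * 'X^(j * n.+1)).
have BS j : B j.+1 = - (1 + 'X^j) * B j.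
  by rewrite /B big_nat_recr //= exprS; ring.
elim: n => [|n IHn].
  rewrite big_nat1 /prodD /theta /B /Q !big_geq // mul0n.
  by rewrite !expr0; ring.
have thS : theta n.+1 = theta n + (-1) ^+ n.+1 * 'X^(n.+1 * n.+1) *+ 2.
  rewrite /theta big_nat_recr //= mulrnDl addrA; congr (_ + _ *+ 2).
  rewrite (exprNn 'X (n.+1 ^ 2)) -signr_odd oddX -mulnn.
  by rewrite -[(-1) ^+ n.+1]signr_odd.
rewrite big_nat_recr //= [X in _ + X](_ : _ = B n.+1 * 'X^(n.+1 * n.+2));
  last first.
  by rewrite /Q big_geq // mulr1.
(* Telescoping certificate: the term of index [j] for [n.+1], minus [1 + 'X^(n.+1)] times the one
   for [n], equals [u j.+1 - u j]. *)
pose u j : {poly K} := B j * 'X^(j * n.+1) * \prod_(j <= i < n.+1) (1 - 'X^i).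
have ES : \sum_(0 <= j < n.+1) B j * Q j n.+1 * 'X^(j * n.+2) =
    (1 + 'X^(n.+1)) * (\sum_(0 <= j < n.+1) B j * Q j n * 'X^(j * n.+1))
    + (u n.+1 - u 0%N).
  rewrite -telescope_sumr // big_distrr -big_split.
  apply: eq_big_nat => j /= jn.
  rewrite /u BS /Q big_nat_recr //= (big_ltn jn).
  by rewrite mulnS mulSn !exprD; ring.
(* The factor [1 + 'X^0] of [B n.+1] is the 2 in front of the new term of [theta]. *)
have Bn : B n.+1 * (1 + 'X^(n.+1)) = (-1) ^+ n.+1 * prodD n.+1 *+ 2.
  rewrite /B /prodD -mulrA -(big_nat_recr n.+1 0) //= big_ltn // expr0; ring.
have u0 : u 0%N = 0 by rewrite /u big_ltn // expr0 subrr mul0r mulr0.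
have uS : u n.+1 = B n.+1 * 'X^(n.+1 * n.+1) by rewrite /u big_geq // mulr1.
rewrite ES u0 uS thS -IHn (mulnSr n.+1 n.+1) exprD.
transitivity ((1 + 'X^(n.+1)) * (prodD n * theta n)
    + 'X^(n.+1 * n.+1) * (B n.+1 * (1 + 'X^(n.+1)))); last by ring.
by rewrite Bn prodDS; ring.
Qed.

Lemma theta_prod n : eqmodX n.+1 (prodD n * theta n) (prodB n).
Proof.
rewrite Gauss_finite big_ltn // expr0 (big_geq (leqnn 0)) !mul1r mul0n mulr1.
move=> i iN; rewrite coefD coef_sum [X in _ + X]big_nat [X in _ + X]big1.
  by rewrite addr0.
move=> j /andP[j0 _].
by rewrite coefMXn (leq_trans iN) // leq_pmull.
Qed.

Lemma prodD0 n : (prodD n)`_0 = 1.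
Proof.
elim: n => [|n IHn]; first by rewrite /prodD big_geq // coef1.
by rewrite prodDS mulrDr mulr1 coefD coefMXn IHn addr0.
Qed.

(** Here [phi(-q)] becomes the inverse of the overpartition series: multiply by [prodD n], apply
    [theta_prod] and [ovp_prod], then cancel [prodD n]. *)
Lemma theta_ovp n : eqmodX n.+1 (theta n * ovp n n.+1) 1.
Proof.
apply: (@eqmodXI _ _ _ (prodD n)); first by rewrite prodD0 oner_neq0.
rewrite mulrA mulr1; apply: (eqmodX_trans _ (@ovp_prod n n)).
apply: eqmodX_trans (eqmodXM (@theta_prod n) (@eqmodX_refl _ _)) _.
(* The last factor [1 - 'X^(n.+1)] of [prodB n.+1] is 1 at this precision. *)
apply/eqmodXM => // i iN.
by rewrite prodBS mulrBr mulr1 coefB coefMXn iN subr0.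
Qed.

(** Only the coefficients up to [n] are meaningful: [bounded_seq n] need not contain the
    overpartitions of larger weight. *)
Definition ovseries (n : nat) : {poly K} :=
  \sum_(t : bounded_seq n | overpartition (seq_of t)) 'X^(weight (seq_of t)).

Lemma ovseries_ovp n : eqmodX n.+1 (ovseries n) (ovp n n.+1).
Proof.
move=> i iN; rewrite coef_sum coef_poly iN /upto /bounded_seqs filter_map.
rewrite size_map size_filter -sum1_count natr_sum big_enum_cond /=.
rewrite big_mkcond [RHS]big_mkcond; apply: eq_bigr => t _ /=.
rewrite coefXn eq_sym; case: eqP => [wt|_]; last by rewrite andbF; case: ifP.
by rewrite andbT overpartition_upto_weight // wt.
Qed.

Lemma p3bar_coef n : (p3bar n)%:R = (ovseries n ^+ 3)`_n.
Proof.
rewrite !exprSr expr0 mul1r /ovseries.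
rewrite big_distrlr pair_big big_distrlr pair_big /=.
rewrite coef_sum /p3bar -sum1_card natr_sum /=.
rewrite big_mkcond [RHS]big_mkcond; apply: eq_bigr => t _ /=.
rewrite inE -!exprD coefXn eq_sym -andbA.
by do 3!case: (overpartition _) => //=; case: eqP.
Qed.

End TruncatedSeries.

(** * Reduction modulo 7 *)

Section Mod7.

Local Open Scope ring_scope.

Lemma big_zrange (R : nmodType) (f : nat -> R) n :
  \sum_(x <- zrange n) f (Z.abs_nat x)
  = f 0%N + (\sum_(1 <= j < n.+1) f j) *+ 2.
Proof.
elim: n => [|n IHn]; first by rewrite big_geq // mul0rn addr0 big_seq1.
have zS : perm_eq (zrange n.+1)
    (Z.of_nat n.+1 :: (- Z.of_nat n.+1)%Z :: zrange n).
  apply: uniq_perm; first exact: zrange_uniq.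
    by rewrite 2!cons_uniq zrange_uniq inE !mem_zrange; lia.
  by move=> x; rewrite mem_zrange 2!in_cons mem_zrange; lia.
rewrite (perm_big _ zS) 2!big_cons IHn [in RHS]big_nat_recr // mulrnDl !addrA.
have -> : Z.abs_nat (Z.of_nat n.+1) = n.+1 by lia.
have -> : Z.abs_nat (- Z.of_nat n.+1) = n.+1 by lia.
by rewrite /= addrC; congr (_ + _); apply: addrC.
Qed.

Lemma theta_zrange (K : fieldType) n :
  theta K n = \sum_(x <- zrange n) (- 'X) ^+ (Z.abs_nat x ^ 2).
Proof. by rewrite (big_zrange (fun j => (- 'X) ^+ (j ^ 2))) expr0. Qed.

Lemma coef_NXn (K : fieldType) k i :
  ((- 'X : {poly K}) ^+ k)`_i = (-1) ^+ i * (k == i)%:R.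
Proof.
rewrite -scaleN1r exprZn coefZ coefXn eq_sym.
by case: eqP => [->|]; rewrite ?mulr0.
Qed.

Lemma abs_nat_sqr x : (Z.abs_nat x ^ 2)%N = Z.abs_nat (x * x).
Proof. by rewrite Zabs2Nat.inj_mul multE mulnn. Qed.

(** When the cube is expanded, the exponents of [- 'X] add up to the norm, so all representations of
    [n] carry the same sign. *)
Lemma coef_theta3 (K : fieldType) B n :
  (theta K B ^+ 3)`_n = (-1) ^+ n * (size (vreps B n))%:R.
Proof.
have -> : theta K B ^+ 3 = \sum_(v <- vbox B) (- 'X) ^+ Z.abs_nat (vnorm v).
  rewrite /vbox !big_allpairs exprS expr2 theta_zrange big_distrlr mulr_suml.
  apply: eq_bigr => x _; rewrite mulr_sumr.
  apply: eq_bigr => y _; rewrite mulr_sumr; apply: eq_bigr => z _ /=.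
  rewrite -!exprD !abs_nat_sqr; congr (_ ^+ _); rewrite /vnorm.
  by move: (Z.square_nonneg x) (Z.square_nonneg y) (Z.square_nonneg z); lia.
rewrite coef_sum -sum1_size big_filter natr_sum mulr_sumr [RHS]big_mkcond.
apply: eq_bigr => v _; rewrite coef_NXn.
have -> : (Z.abs_nat (vnorm v) == n) = Z.eqb (vnorm v) (Z.of_nat n).
  have : Z.le Z0 (vnorm v) by case: v => [[x y] z] /=; nia.
  lia.
by case: ifP; rewrite ?mulr0 ?mulr1.
Qed.

Lemma coef_theta4 (K : fieldType) B n :
  (theta K B ^+ 4)`_n = (-1) ^+ n * (size (qreps B n))%:R.
Proof.
have -> : theta K B ^+ 4 = \sum_(v <- qbox B) (- 'X) ^+ Z.abs_nat (qnorm v).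
  rewrite /qbox /vbox !big_allpairs !exprS expr0 mulr1 theta_zrange.
  rewrite big_distrlr mulr_suml.
  apply: eq_bigr => x _; rewrite mulr_suml mulr_sumr.
  apply: eq_bigr => y _; rewrite !mulr_sumr.
  apply: eq_bigr => z _; rewrite !mulr_sumr; apply: eq_bigr => t _ /=.
  rewrite -!exprD !abs_nat_sqr; congr (_ ^+ _); rewrite /qnorm.
  move: (Z.square_nonneg x) (Z.square_nonneg y) (Z.square_nonneg z).
  by move: (Z.square_nonneg t); lia.
rewrite coef_sum -sum1_size big_filter natr_sum mulr_sumr [RHS]big_mkcond.
apply: eq_bigr => v _; rewrite coef_NXn.
have -> : (Z.abs_nat (qnorm v) == n) = Z.eqb (qnorm v) (Z.of_nat n).
  have : Z.le Z0 (qnorm v) by case: v => [[[x y] z] t] /=; nia.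
  lia.
by case: ifP; rewrite ?mulr0 ?mulr1.
Qed.

Lemma natr_F7 m n : (m%:R == n%:R :> 'F_7) = (m == n %[mod 7]).
Proof. by rewrite -val_eqE /= !val_Fp_nat. Qed.

Lemma coef_mul_theta7 (p : {poly 'F_7}) B i :
  (p * theta _ B ^+ 7)`_(7 * i)
  = ((\poly_(j < size p) p`_(7 * j)) * theta _ B)`_i.
Proof.
have ch7 : 7%N \in [pchar {poly 'F_7}] by rewrite pchar_poly pchar_Fp.
rewrite theta_zrange -(pFrobenius_autE ch7) rmorph_sum !mulr_sumr !coef_sum.
apply: eq_bigr => x _ /=; rewrite pFrobenius_autE -exprM; move: (_ ^ 2)%N => k.
rewrite -!scaleN1r !exprZn -!scalerAr !coefZ !coefMXn coef_poly.
rewrite mulnC exprM -[(-1) ^+ 7]signr_odd expr1 ltn_pmul2l // -mulnBr.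
case: ltnP => // _; congr (_ * _); case: ltnP => // p_le.
by apply: nth_default; rewrite (leq_trans p_le) // leq_pmull.
Qed.

Lemma p3bar_mod7 m :
  (p3bar (7 * m))%:R = (-1) ^+ m * (size (vreps (7 * m) m))%:R :> 'F_7.
Proof.
(* This precision makes the coefficients of index [7 * i] correct for all [i <= m]. *)
set N := (7 * m)%N; pose th := theta 'F_7 N; pose P := ovseries 'F_7 N ^+ 3.
have P_th : eqmodX N.+1 (P * th ^+ 3) 1.
  rewrite -exprMn -(expr1n _ 3); apply: eqmodXX.
  apply: (eqmodX_trans _ (@theta_ovp _ N)); rewrite mulrC.
  by apply: eqmodXM => //; apply: ovseries_ovp.
pose U := \poly_(j < size P) P`_(7 * j).
(* Extract the exponents divisible by 7 from [P * th ^+ 7 = th ^+ 4]; on the right [r_4(7 i)] is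
   replaced by [r_4(i)]. *)
have U_th : eqmodX m.+1 (th * U) (th * th ^+ 3).
  move=> i; rewrite ltnS => im; rewrite mulrC -coef_mul_theta7.
  rewrite [th ^+ 7](exprD th 3 4) mulrA.
  have iN : (7 * i < N.+1)%N by rewrite ltnS leq_pmul2l.
  rewrite (eqmodXM P_th (@eqmodX_refl _ N.+1 (th ^+ 4)) iN) mul1r -exprS.
  rewrite !coef_theta4 -signr_odd oddM /= signr_odd; congr (_ * _).
  by apply/eqP; rewrite natr_F7 qreps_mod7.
rewrite p3bar_coef -/N -/P -coef_theta3.
have th0 : th`_0 != 0.
  have := @theta_ovp 'F_7 N 0 isT; rewrite coefM big_ord1 coef1 eqxx => th_ov.
  by apply: contra_eq_neq th_ov => ->; rewrite mul0r eq_sym oner_neq0.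
rewrite -(eqmodXI th0 U_th (ltnSn m)) coef_poly; case: ltnP => // p_le.
by apply: nth_default; rewrite (leq_trans p_le) // leq_pmull.
Qed.

End Mod7.

(** * Powers of 49 and the congruences for overpartition triples *)

Lemma size_vreps_box B C n : n <= B -> n <= C ->
  size (vreps B n) = size (vreps C n).
Proof.
move=> nB nC; apply/perm_size/uniq_perm; rewrite ?vreps_uniq // => v.
by rewrite !mem_vreps.
Qed.

Lemma p3bar_vreps B m : m <= B ->
  ((p3bar (7 * m))%:R = (-1) ^+ m * (size (vreps B m))%:R :> 'F_7)%R.
Proof. by move=> mB; rewrite p3bar_mod7 (@size_vreps_box _ B) // leq_pmull. Qed.

(** [vreps_mod7] removes a factor 49 as long as a further 7 remains, which another 49 supplies; the
    last 49 is left to [vreps_nonresidue]. *)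
Lemma vreps_nonresidue_pow B a m : 0 < a -> 49 ^ a * m <= B ->
  m %% 7 \in [:: 3; 5; 6] -> size (vreps B (49 ^ a * m)) = 0 %[mod 7].
Proof.
case: a => // a _; elim: a => [|a IHa] aB m_nr; first exact: vreps_nonresidue.
have E : 49 ^ a.+1 * m = 7 * (7 * (49 ^ a * m)) by rewrite expnS !mulnA.
rewrite expnS -mulnA E in aB *.
rewrite vreps_mod7 // -E; apply: IHa => //; rewrite E.
by apply: leq_trans aB; rewrite leq_pmull.
Qed.

Lemma p3bar_nonresidue a m : 0 < a -> m %% 7 \in [:: 3; 5; 6] ->
  p3bar (7 ^ (2 * a + 1) * m) = 0 %[mod 7].
Proof.
move=> a0 m_nr; rewrite addn1 expnS -mulnA expnM; apply/eqP.
rewrite -natr_F7 (p3bar_vreps (leqnn _)).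
have /eqP := vreps_nonresidue_pow a0 (leqnn _) m_nr.
by rewrite -natr_F7 => /eqP->; rewrite mulr0.
Qed.

Theorem theorem4p5 (n alpha : nat) (halpha : 1 <= alpha) :
  p3bar (7 ^ 4 * n) = p3bar (7 ^ 2 * n) %[mod 7] /\
  [/\ p3bar (7 ^ (2 * alpha + 1) * (7 * n + 3)) = 0 %[mod 7],
      p3bar (7 ^ (2 * alpha + 1) * (7 * n + 5)) = 0 %[mod 7]
    & p3bar (7 ^ (2 * alpha + 1) * (7 * n + 6)) = 0 %[mod 7]].
Proof.
split; last by split; apply: p3bar_nonresidue => //; rewrite mulnC modnMDl.
have -> : 7 ^ 4 * n = 7 * (49 * (7 * n)) by rewrite !mulnA.
have -> : 7 ^ 2 * n = 7 * (7 * n) by rewrite !mulnA.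
(* The larger of the two norms, so that one box serves both. *)
pose B := 49 * (7 * n); have nB : 7 * n <= B by rewrite leq_pmull.
apply/eqP; rewrite -natr_F7 (p3bar_vreps nB) (p3bar_vreps (leqnn B)).
have /eqP := @vreps_mod7 B n (leqnn _); rewrite -natr_F7 => /eqP->.
(* The signs agree because 49 is odd. *)
by rewrite -signr_odd oddM /= signr_odd.
Qed.
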